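(* Let $n$ be a positive integer, and let $m_0(n)$ be the minimum positive integer $m$ for which there exists an absolutely diffusive map $a_n:\{0,1\}^n\to\{0,1\}^m$. Then such an $m$ exists and $$m_0(n)=\begin{cases} n+2 & \text{if } n\equiv 0\pmod 4,\\ n+1 & \text{if } n\equiv 1\pmod 4,\\ n & \text{if } n\equiv 2\pmod 4,\\ n+1 & \text{if } n\equiv 3\pmod 4.\end{cases}$$ Moreover, for every even integer $m> m_0(n)$ there exists an absolutely diffusive map $\{0,1\}^n\to\{0,1\}^m$.
   Context: For a positive integer $n$, $\{0,1\}^n$ denotes the set of $n$-bit binary strings. The Hamming distance $h(x,y)$ between two strings $x,y$ of the same length is the number of positions at which they differ. $E_n$ denotes the set of unordered pairs $\{x,y\}$ of elements of $\{0,1\}^n$ with $h(x,y)=1$ (the edges of the $n$-dimensional hypercube). A function $a:\{0,1\}^n\to\{0,1\}^m$ is called absolutely diffusive if it is injective, $m$ is even, and $h(a(x),a(y))=\frac{m}{2}$ for every $\{x,y\}\in E_n$. *)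

(* Defs.v *)
From mathcomp Require Import all_boot.

Set Implicit Arguments.
Unset Strict Implicit.
Unset Printing Implicit Defensive.

Definition hamming (n : nat) (x y : n.-tuple bool) : nat :=
  #|[set i : 'I_n | tnth x i != tnth y i]|.

Definition cube_edges (n : nat) : {set {set n.-tuple bool}} :=
  [set e | [exists x : n.-tuple bool, exists y : n.-tuple bool,
    (e == [set x; y]) && (hamming x y == 1)]].

Definition absolutely_diffusive (n m : nat)
    (a : n.-tuple bool -> m.-tuple bool) : Prop :=
  [/\ injective a,
      ~~ odd m &
      forall x y : n.-tuple bool,
        [set x; y] \in cube_edges n -> hamming (a x) (a y) = m./2].

Definition has_absolutely_diffusive (n m : nat) : Prop :=
  exists a : n.-tuple bool -> m.-tuple bool, absolutely_diffusive a.

Definition is_min_diffusive_length (n m0 : nat) : Prop :=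
  [/\ 0 < m0,
      has_absolutely_diffusive n m0 &
      forall m : nat, 0 < m -> has_absolutely_diffusive n m -> m0 <= m].

(* Main.v *)
(** Injectivity forces [n <= m]. If [m / 2] is even, all values of the map have
    the same parity, because the cube is connected by edges; then the map is
    not onto and [n < m]. Conversely, over the field with two elements, the
    vectors of weight [m / 2] have rank [m] if [m / 2] is odd and at least
    [m - 1] otherwise: a linear form vanishing on all of them has all its
    coefficients equal. So one can choose [n] independent ones, and the linear
    map sending the standard basis to them is absolutely diffusive. Thus an even
    [m] is suitable iff [n <= m], and moreover [n < m] when 4 divides [m]. *)

Require Import Defs.
From mathcomp Require Import all_boot.
From mathcomp Require Import all_algebra.
From mathcomp Require Import zify.

Set Implicit Arguments.
Unset Strict Implicit.
Unset Printing Implicit Defensive.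

Lemma mem_cube_edges (n : nat) (x y : n.-tuple bool) :
  ([set x; y] \in cube_edges n) = (hamming x y == 1).
Proof.
have hammingC u v : hamming u v = hamming v u :> nat.
  by apply: eq_card => i; rewrite !inE eq_sym.
rewrite inE; apply/existsP/idP => [[u /existsP[v /andP[/eqP uv huv]]] | hxy].
  have hxx (z : n.-tuple bool) : hamming z z = 0.
    by apply: eq_card0 => i; rewrite !inE eqxx.
  have := set21 x y; have := set22 x y; rewrite uv.
  have := set21 u v; have := set22 u v; rewrite -uv !inE.
  (* Cases identifying the two endpoints would make the distance of an edge zero; what remains is
     the same pair, possibly swapped. *)
  do 4![case/orP=> /eqP ?]; subst; rewrite ?hxx // in huv *.
  by rewrite hammingC.
by exists x; apply/existsP; exists y; rewrite eqxx.
Qed.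

Definition parity (n : nat) (x : n.-tuple bool) : bool :=
  \big[addb/false]_(i < n) tnth x i.

Lemma odd_hamming (n : nat) (x y : n.-tuple bool) :
  odd (hamming x y) = parity x (+) parity y.
Proof.
rewrite /hamming -sum1_card big_mkcond (big_morph odd oddD (erefl _)).
rewrite /parity -big_split; apply: eq_bigr => i _.
by rewrite inE; case: (tnth x i); case: (tnth y i).
Qed.

Definition flip (n : nat) (i : 'I_n) (x : n.-tuple bool) : n.-tuple bool :=
  [tuple tnth x j (+) (j == i) | j < n].

Lemma hamming_flip (n : nat) (i : 'I_n) (x : n.-tuple bool) :
  hamming x (flip i x) = 1.
Proof.
rewrite /hamming (_ : [set _ | _] = [set i]) ?cards1 //.
by apply/setP=> j; rewrite !inE tnth_mktuple; case: (tnth x j); case: (j == i).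
Qed.

(** Induction on the distance: flipping [x] at a position where it differs from [y] brings it one
    step closer. *)
Lemma flip_connected (T : Type) (n : nat) (f : n.-tuple bool -> T) :
  (forall i x, f (flip i x) = f x) -> forall x y, f x = f y.
Proof.
move=> f_flip x y; move h_xy: (hamming x y) => k.
elim: k => [|k IHk] in x h_xy *.
  congr f; apply: eq_from_tnth => i; apply/eqP.
  by have := card0_eq h_xy i; rewrite !inE => /negbFE.
have /card_gt0P[i] : 0 < hamming x y by rewrite h_xy.
rewrite inE => xyi; rewrite -(f_flip i); apply: IHk.
apply: succn_inj; rewrite -h_xy /hamming [RHS](cardsD1 i) inE xyi.
congr _.+1; apply: eq_card => j; rewrite !inE tnth_mktuple.
have [-> | _] := eqVneq j i; rewrite ?addbF //.
by case: (tnth x i) (tnth y i) xyi => [] [].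
Qed.

Lemma absolutely_diffusive_leq (n m : nat)
    (a : n.-tuple bool -> m.-tuple bool) :
  absolutely_diffusive a -> n <= m.
Proof.
case=> a_inj _ _; have := leq_card a a_inj.
by rewrite !card_tuple card_bool leq_exp2l.
Qed.

Lemma absolutely_diffusive_ltn (n m : nat)
    (a : n.-tuple bool -> m.-tuple bool) :
  0 < m -> ~~ odd m./2 -> absolutely_diffusive a -> n < m.
Proof.
move=> m_gt0 even_m2 diff_a; have n_le_m := absolutely_diffusive_leq diff_a.
rewrite ltn_neqAle n_le_m andbT; apply/eqP=> eq_nm; subst m.
have [a_inj _ a_edge] := diff_a.
have parity_a x y : parity (a x) = parity (a y).
  apply: (@flip_connected _ _ (fun z => parity (a z))) => {x y} i x.
  have /a_edge h : [set x; flip i x] \in cube_edges n.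
    by rewrite mem_cube_edges hamming_flip.
  have := odd_hamming (a x) (a (flip i x)); rewrite h (negPf even_m2).
  by case: (parity _); case: (parity _).
(* For [n = m] the map is onto, so [flip i z] is also a value, yet its parity is opposite to that of
   [z]. *)
have [b _ bK] := inj_card_bij a_inj (leqnn _).
pose x0 := [tuple false | _ < n]; pose z := a x0; pose i := Ordinal m_gt0.
have := odd_hamming z (flip i z).
by rewrite hamming_flip -(bK (flip i z)) (parity_a _ x0) addbb.
Qed.

Lemma ex_subset_card (T : finType) (A : {set T}) (k : nat) :
  k <= #|A| -> exists2 B : {set T}, B \subset A & #|B| = k.
Proof.
rewrite -bin_gt0 -cards_draws => /card_gt0P[B].
by rewrite inE => /andP[sBA /eqP cB]; exists B.
Qed.

Section ConstantWeight.
Import GRing.Theory.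
Local Open Scope ring_scope.

Variables (m k : nat).

Definition weight_sets : {set {set 'I_m}} := [set S : {set 'I_m} | #|S| == k].

(** Here [bool] is the field with two elements; the rows are the indicator vectors of the
    [k]-subsets. *)
Definition weight_mx : 'M[bool]_(#|weight_sets|, m) :=
  \matrix_(i < #|weight_sets|, j < m) (j \in (enum_val i : {set 'I_m})).

Lemma weight_mx_ker (c : 'rV[bool]_m) : c *m weight_mx^T = 0 ->
  forall S : {set 'I_m}, #|S| = k -> \sum_(j in S) c 0 j = 0.
Proof.
move=> cW0 S cS; have SW : S \in weight_sets by rewrite inE cS.
have /rowP/(_ (enum_rank_in SW S)) := cW0; rewrite !mxE => {2}<-.
rewrite big_mkcond; apply: eq_bigr => j _.
by rewrite !mxE enum_rankK_in //; case: ifP; rewrite ?mulr1 ?mulr0.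
Qed.

(** Choose [D] with [k - 1] elements avoiding [i] and [j]; comparing the zero sums over [i |: D] and
    [j |: D] gives [c 0 i = c 0 j]. *)
Lemma weight_mx_ker_const (c : 'rV[bool]_m) : (0 < k < m)%N ->
  c *m weight_mx^T = 0 -> forall i j, c 0 i = c 0 j.
Proof.
move=> /andP[k_gt0 k_lt_m] /weight_mx_ker cS i j.
have [-> // | neq_ij] := eqVneq i j.
have [|D] := @ex_subset_card _ (~: [set i; j]) k.-1.
  have := cardsC [set i; j]; rewrite cards2 neq_ij card_ord => eq_m.
  by rewrite -(leq_add2l 2) eq_m; case: (k) k_gt0 k_lt_m.
rewrite subsetC subUset !sub1set !inE => /andP[iD jD] cD.
have cU l : l \notin D -> #|l |: D| = k.
  by rewrite cardsU1 cD => ->; apply: prednK.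
have := cS _ (cU _ jD); rewrite -{2}(cS _ (cU _ iD)) !big_setU1 //=.
by move/addIr.
Qed.

Lemma rank_weight_mx : (0 < k < m)%N -> (m.-1 + odd k <= \rank weight_mx)%N.
Proof.
move=> k_bnd; have /andP[k_gt0 k_lt_m] := k_bnd.
suffices: (\rank (kermx weight_mx^T) <= ~~ odd k)%N.
  rewrite mxrank_ker mxrank_tr leq_subLR => rank_ge.
  move: (\rank _) rank_ge => r; have := leq_trans k_gt0 (ltnW k_lt_m).
  by case: (m) => // m' _; case: (odd k); rewrite /= ?addn0 addnC // addn1.
have row_ker i : row i (kermx weight_mx^T) *m weight_mx^T = 0.
  by rewrite -row_mul mulmx_ker row0.
have [k_odd | k_even] /= := boolP (odd k).
  rewrite leqn0 mxrank_eq0; apply/eqP/row_matrixP => i; rewrite row0.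
  have c_const := weight_mx_ker_const k_bnd (row_ker i).
  have [|S _ cS] := @ex_subset_card _ [set: 'I_m] k.
    by rewrite cardsT card_ord ltnW.
  apply/rowP=> j; have := weight_mx_ker (row_ker i) cS.
  rewrite (eq_bigr (fun=> row i (kermx weight_mx^T) 0 j)); last first.
    by move=> l _; apply: c_const.
  (* Doubles vanish in characteristic two, so [k] equal terms with [k] odd sum to a single one,
     which is therefore zero. *)
  rewrite sumr_const cS -[k]odd_double_half k_odd -mul2n mulrnDr mulrnA.
  have add2b (b : bool) : b *+ 2 = 0 by case: b.
  by rewrite add2b mul0rn addr0 => row_ij0; rewrite [RHS]mxE; apply: row_ij0.
(* For even [k] the kernel lies in the line spanned by the all-ones vector. *)
apply: leq_trans (rank_leq_row (const_mx true : 'rV[bool]_m)).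
apply/mxrankS/row_subP => i; apply/sub_rVP.
have j0 : 'I_m := Ordinal (leq_trans k_gt0 (ltnW k_lt_m)).
exists (row i (kermx weight_mx^T) 0 j0); apply/rowP=> j.
rewrite (weight_mx_ker_const k_bnd (row_ker i) j j0) [RHS]mxE.
by rewrite [const_mx _ _ _]mxE mulr1.
Qed.

End ConstantWeight.

Lemma ex_independent_weight (n m k : nat) :
  0 < k < m -> n <= m.-1 + odd k ->
  exists2 V : 'M[bool]_(n, m), row_free V &
    forall i, #|[set j | V i j]| = k.
Proof.
move=> k_bnd n_le; have n_le_r := leq_trans n_le (rank_weight_mx k_bnd).
pose B := rowsub (maxrankfun (weight_mx m k)) (weight_mx m k).
exists (rowsub (widen_ord n_le_r) B).
  have B_free : row_free B by apply: maxrowsub_free.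
  (* Selecting the first [n] rows is multiplication by [pid_mx n], and the row-free factor [B]
     preserves its rank. *)
  rewrite /row_free rowsubE mxrankMfree // (_ : rowsub _ _ = pid_mx n).
    by rewrite rank_pid_mx.
  by apply/matrixP=> i j; rewrite !mxE ltn_ord andbT.
move=> i; have := enum_valP (maxrankfun (weight_mx m k) (widen_ord n_le_r i)).
rewrite inE => /eqP; apply: etrans.
by apply: eq_card => j; rewrite inE !mxE.
Qed.

Lemma has_absolutely_diffusive_linear (n m : nat) :
  0 < m -> ~~ odd m -> n <= m.-1 + odd m./2 -> has_absolutely_diffusive n m.
Proof.
move=> m_gt0 m_even n_le.
have m2 : (0 < m./2 < m)%N.
  lia.
have [V V_free V_wt] := ex_independent_weight m2 n_le.
pose toV (x : n.-tuple bool) : 'rV[bool]_n := (\row_j tnth x j)%R.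
exists (fun x => [tuple (toV x *m V)%R ord0 j | j < m]).
split=> // [x y eq_xy | x y].
  have /(row_free_inj V_free)/rowP e : (toV x *m V = toV y *m V)%R.
    apply/rowP=> j; have := congr1 (fun t => tnth t j) eq_xy.
    by rewrite !tnth_mktuple.
  by apply: eq_from_tnth => j; have := e j; rewrite !mxE.
rewrite mem_cube_edges => /cards1P[i /setP xy_i]; rewrite -(V_wt i).
(* Along an edge in direction [i] the inputs differ by a basis vector, so the images differ by row
   [i] of [V], of weight [m./2]. *)
have toVB : (toV x - toV y = delta_mx 0 i)%R.
  apply/rowP=> j; have := xy_i j; rewrite !inE !mxE /= => <-.
  by case: (tnth x j) (tnth y j) => [] [].
apply: eq_card => j; rewrite !inE !tnth_mktuple.
have /rowP/(_ j) : ((toV x - toV y) *m V = row i V)%R by rewrite toVB -rowE.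
rewrite mulmxBl !mxE => <-.
by case: (\sum_(_ < n) _)%R (\sum_(_ < n) _)%R => [] [].
Qed.

Theorem theorem5 (n : nat) (n_gt0 : 0 < n) :
  exists m0 : nat,
    [/\ is_min_diffusive_length n m0,
        [/\ n = 0 %[mod 4] -> m0 = n + 2,
            n = 1 %[mod 4] -> m0 = n + 1,
            n = 2 %[mod 4] -> m0 = n &
            n = 3 %[mod 4] -> m0 = n + 1] &
        forall m : nat, ~~ odd m -> m0 < m -> has_absolutely_diffusive n m].
Proof.
have lower m : 0 < m -> has_absolutely_diffusive n m ->
    [/\ ~~ odd m, n <= m & ~~ odd m./2 -> n < m].
  move=> m_gt0 [a diff_a]; have [_ m_even _] := diff_a; split=> //.
    exact: absolutely_diffusive_leq diff_a.
  by move=> m2_even; apply: absolutely_diffusive_ltn diff_a.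
have upper m : ~~ odd m -> n <= m -> (~~ odd m./2 -> n < m) ->
    has_absolutely_diffusive n m.
  move=> m_even n_le n_lt; apply: has_absolutely_diffusive_linear => //.
    exact: leq_trans n_le.
  by case: (odd m./2) n_lt => [_ | /(_ isT)]; lia.
(* The least even number that is at least [n], except that [n] itself is excluded when 4 divides it;
   then [n + 2] has odd half. For [n] equal to 3 modulo 4, [n + 1] has even half but already exceeds
   [n]. *)
pose m0 := nth 0 [:: n + 2; n + 1; n; n + 1] (n %% 4).
have m0E : [/\ n %% 4 = 0 -> m0 = n + 2, n %% 4 = 1 -> m0 = n + 1,
    n %% 4 = 2 -> m0 = n & n %% 4 = 3 -> m0 = n + 1].
  by rewrite /m0; split=> ->.
have n_mod4 : n %% 4 < 4 by rewrite ltn_mod.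
exists m0; clearbody m0; case: m0E => m0_0 m0_1 m0_2 m0_3.
split; first split.
- lia.
- by apply: upper; lia.
- by move=> m m_gt0 /(lower _ m_gt0)[]; lia.
- by split; rewrite [RHS]modn_small.
- by move=> m m_even lt_m0m; apply: upper => //; lia.
Qed.
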